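(* Let $(\bar x,\bar y,\bar u)$ be a local optimal solution to problem (CP). Suppose that (CP) is partially calm at $(\bar x,\bar y,\bar u)$ and that there is $\bar w\in\mathbb{R}^l$ such that $(\bar x,\bar y,\bar u,\bar w)$ is a local optimal solution of (GCP). Then (GCP) is also partially calm at $(\bar x,\bar y,\bar u,\bar w)$.
   Context: $F:\mathbb{R}^n\times\mathbb{R}^m\to\mathbb{R}$ is continuously differentiable; $f:\mathbb{R}^n\times\mathbb{R}^m\to\mathbb{R}$ and $g:\mathbb{R}^n\times\mathbb{R}^m\to\mathbb{R}^p$ are three times continuously differentiable; $H_2:\mathbb{R}^n\times\mathbb{R}^m\times\mathbb{R}^p\times\mathbb{R}^l\to K$ is continuously differentiable, $K$ is a Euclidean space and $C\subseteq K$ is nonempty and convex. The value function is $V(x):=\inf_y\{f(x,y): g(x,y)\le 0\}$ (extended real-valued). Put $H_1(x,y,u):=\nabla_y f(x,y)+\sum_{i=1}^p u_i\nabla_y g_i(x,y)$. (CP): minimize $F(x,y)$ over $(x,y,u)$ subject to $f(x,y)-V(x)\le 0$, $H_1(x,y,u)=0$, $g(x,y)\le 0$, $u\ge 0$, $u^Tg(x,y)=0$. (GCP): minimize $F(x,y)$ over $(x,y,u,w)$ subject to $f(x,y)-V(x)\le 0$, $g(x,y)\le 0$, $u\ge 0$, $u^Tg(x,y)=0$, $H_1(x,y,u)=0$, $H_2(x,y,u,w)\in C$. Partial calmness: (CP) is partially calm at a local solution $(\bar x,\bar y,\bar u)$ if there exists $\mu\ge 0$ such that $(\bar x,\bar y,\bar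 u)$ is a local solution of the problem obtained from (CP) by deleting the constraint $f(x,y)-V(x)\le 0$ and replacing the objective by $F(x,y)+\mu(f(x,y)-V(x))$. Likewise, (GCP) is partially calm at a local solution $(\bar x,\bar y,\bar u,\bar w)$ if there exists $\mu\ge 0$ such that $(\bar x,\bar y,\bar u,\bar w)$ is a local solution of the problem obtained from (GCP) by deleting $f(x,y)-V(x)\le 0$ and replacing the objective by $F(x,y)+\mu(f(x,y)-V(x))$. *)

(* Defs.v *)
From HB Require Import structures.
From mathcomp Require Import all_boot all_order all_algebra.
From mathcomp Require Import all_classical all_reals all_analysis.
Set Implicit Arguments.
Unset Strict Implicit.
Unset Printing Implicit Defensive.
Import Order.TTheory GRing.Theory Num.Theory.
Import numFieldNormedType.Exports.
Local Open Scope classical_set_scope.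
Local Open Scope ring_scope.

(* The spaces R^n are 'rV[R]_n; the library equips them, and their products,
   with the maximum norm, which induces the same topology and the same
   differentials as the Euclidean norm. *)

(* K is a Euclidean space for the inner product ip: it is finite dimensional
   and its norm is the one induced by ip. Positive definiteness is part of the
   type of ip. *)
Definition is_euclidean (R : realType) (K : normedModType R)
    (ip : {dot K for idfun}) : Prop :=
  (forall a : K, `|a| = Num.sqrt (ip a a)) /\
  exists (d : nat) (e : 'I_d -> K),
    forall a : K, exists c : 'I_d -> R, a = \sum_(i < d) c i *: e i.

(* C^k maps. Continuity of the k-th differential is expressed by continuity of
   the iterated directional derivatives; for a finite-dimensional domain U, the
   only case used, the two are the same. *)
Fixpoint cont_diff (R : realType) (U W : normedModType R) (k : nat)
    (h : U -> W) : Prop :=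
  if k is k'.+1 then
    (forall a, differentiable h a) /\ (forall v, cont_diff k' ('D_v h))
  else continuous h.

Definition gradient (R : realType) (m : nat) (h : 'rV[R]_m -> R)
    (y : 'rV[R]_m) : 'rV[R]_m :=
  \row_(j < m) 'D_(delta_mx 0 j) h y.

Section Bilevel.
Variables (R : realType) (n m p : nat).
Variables (F f : 'rV[R]_n * 'rV[R]_m -> R).
Variable (g : 'rV[R]_n * 'rV[R]_m -> 'rV[R]_p).

(* Equal to +oo when no y is feasible for x. *)
Definition value_function (x : 'rV[R]_n) : \bar R :=
  ereal_inf [set (f (x, y))%:E | y in [set y | forall i, g (x, y) 0 i <= 0]].

Definition H1 (x : 'rV[R]_n) (y : 'rV[R]_m) (u : 'rV[R]_p) : 'rV[R]_m :=
  gradient (fun y' => f (x, y')) y +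
  \sum_(i < p) u 0 i *: gradient (fun y' => g (x, y') 0 i) y.

(* f(x, y) - V(x) *)
Definition value_gap (x : 'rV[R]_n) (y : 'rV[R]_m) : \bar R :=
  ((f (x, y))%:E - value_function x)%E.

(* The objective of the partially penalized problems. At points with
   g(x, y) <= 0, value_gap x y is nonnegative, and it is +oo if
   V(x) = -oo; the library's convention 0 * +oo = 0 makes the penalty vanish
   for mu = 0. *)
Definition penalized_objective (mu : R) (x : 'rV[R]_n) (y : 'rV[R]_m) :
    \bar R :=
  ((F (x, y))%:E + mu%:E * value_gap x y)%E.

Definition local_solution (T : topologicalType) (S : set T) (phi : T -> \bar R)
    (z : T) : Prop :=
  S z /\ \forall z' \near z, S z' -> (phi z <= phi z')%E.

(* Constraints of (CP) other than f(x, y) - V(x) <= 0. *)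
Definition CP_relaxed : set ('rV[R]_n * 'rV[R]_m * 'rV[R]_p) :=
  [set z : 'rV[R]_n * 'rV[R]_m * 'rV[R]_p |
    let: (x, y, u) := z in
    [/\ H1 x y u = 0,
        forall i, g (x, y) 0 i <= 0,
        forall i, 0 <= u 0 i &
        \sum_(i < p) u 0 i * g (x, y) 0 i = 0]].

Definition CP_feasible : set ('rV[R]_n * 'rV[R]_m * 'rV[R]_p) :=
  [set z : 'rV[R]_n * 'rV[R]_m * 'rV[R]_p |
    let: (x, y, u) := z in
    (value_gap x y <= 0)%E /\ CP_relaxed (x, y, u)].

Definition CP_local_solution (z : 'rV[R]_n * 'rV[R]_m * 'rV[R]_p) : Prop :=
  local_solution CP_feasible (fun '(x, y, u) => (F (x, y))%:E) z.

Definition CP_partially_calm (z : 'rV[R]_n * 'rV[R]_m * 'rV[R]_p) : Prop :=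
  exists2 mu : R, 0 <= mu &
    local_solution CP_relaxed (fun '(x, y, u) => penalized_objective mu x y) z.

Variables (l : nat) (K : normedModType R).
Variable (H2 : 'rV[R]_n * 'rV[R]_m * 'rV[R]_p * 'rV[R]_l -> K).
Variable (C : set K).

(* Constraints of (GCP) other than f(x, y) - V(x) <= 0. *)
Definition GCP_relaxed : set ('rV[R]_n * 'rV[R]_m * 'rV[R]_p * 'rV[R]_l) :=
  [set z : 'rV[R]_n * 'rV[R]_m * 'rV[R]_p * 'rV[R]_l |
    let: (x, y, u, w) := z in
    [/\ forall i, g (x, y) 0 i <= 0,
        forall i, 0 <= u 0 i,
        \sum_(i < p) u 0 i * g (x, y) 0 i = 0,
        H1 x y u = 0 &
        C (H2 (x, y, u, w))]].

Definition GCP_feasible : set ('rV[R]_n * 'rV[R]_m * 'rV[R]_p * 'rV[R]_l) :=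
  [set z : 'rV[R]_n * 'rV[R]_m * 'rV[R]_p * 'rV[R]_l |
    let: (x, y, u, w) := z in
    (value_gap x y <= 0)%E /\ GCP_relaxed (x, y, u, w)].

Definition GCP_local_solution
    (z : 'rV[R]_n * 'rV[R]_m * 'rV[R]_p * 'rV[R]_l) : Prop :=
  local_solution GCP_feasible (fun '(x, y, u, w) => (F (x, y))%:E) z.

Definition GCP_partially_calm
    (z : 'rV[R]_n * 'rV[R]_m * 'rV[R]_p * 'rV[R]_l) : Prop :=
  exists2 mu : R, 0 <= mu &
    local_solution GCP_relaxed
      (fun '(x, y, u, w) => penalized_objective mu x y) z.

End Bilevel.

(* Main.v *)
Require Import Defs.
From HB Require Import structures.
From mathcomp Require Import all_boot all_order all_algebra.
From mathcomp Require Import all_classical all_reals all_analysis.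
Set Implicit Arguments.
Unset Strict Implicit.
Unset Printing Implicit Defensive.
Import Order.TTheory GRing.Theory Num.Theory.
Import numFieldNormedType.Exports.
Local Open Scope classical_set_scope.
Local Open Scope ring_scope.

(* The penalty parameter mu of (CP) also serves for (GCP): forgetting w is continuous and
   maps the relaxed feasible set of (GCP) into that of (CP), and the penalized
   objective does not depend on w. *)
Theorem mainTheorem3 (R : realType) (n m p l : nat)
  (F f : 'rV[R]_n * 'rV[R]_m -> R)
  (g : 'rV[R]_n * 'rV[R]_m -> 'rV[R]_p)
  (K : normedModType R) (ip : {dot K for idfun}) (C : set K)
  (H2 : 'rV[R]_n * 'rV[R]_m * 'rV[R]_p * 'rV[R]_l -> K)
  (F_C1 : cont_diff 1 F) (f_C3 : cont_diff 3 f) (g_C3 : cont_diff 3 g)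
  (H2_C1 : cont_diff 1 H2)
  (K_euclidean : is_euclidean ip)
  (C_nonempty : C !=set0) (C_convex : @convex_set R K C)
  (x : 'rV[R]_n) (y : 'rV[R]_m) (u : 'rV[R]_p)
  (CP_sol : CP_local_solution F f g (x, y, u))
  (CP_calm : CP_partially_calm F f g (x, y, u))
  (w : 'rV[R]_l)
  (GCP_sol : GCP_local_solution F f g H2 C (x, y, u, w)) :
  GCP_partially_calm F f g H2 C (x, y, u, w).
Proof.
have [mu mu_ge0 [_ CP_near]] := CP_calm.
(* This supplies the constraint [C (H2 (x, y, u, w))], about which partial calmness of (CP) says
   nothing. *)
have [[_ GCP_xyuw] _] := GCP_sol.
exists mu => //; split; first exact: GCP_xyuw.
(* Neighbourhoods of [(x, y, u, w)] form the product filter of those of [(x, y, u)] and of [w], so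
   [CP_near] pulls back along the first projection. *)
have GCP_near := @cvg_fst _ _ (nbhs (x, y, u)) (nbhs w) _ _ CP_near.
apply: (@filterS _ _ (nbhs_filter (x, y, u, w))); last exact: GCP_near.
(* Without membership in [C], the constraints left are, up to order, the premise [CP_relaxed] of
   [mu_le]. *)
move=> [[[x' y'] u'] w'] /= mu_le [g_le0 u_ge0 ug0 H1_0 _].
exact: mu_le.
Qed.
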